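(* Let $k$ be a commutative ring, let $(\mathcal{O},\mu)$ be an operad with multiplication in the category of $k$-modules (with unit $e\in\mathcal{O}(0)$), and let $\mathcal{M}$ be a cyclic unital comp module over $\mathcal{O}$, with operations $\bullet_i$ and operator $t$. Then $\mathcal{M}$ defines a cyclic $k$-module whose module in degree $n$ is $\mathcal{M}(n)$, with cyclic operator $t:\mathcal{M}(n)\to\mathcal{M}(n)$, and with faces $d_i:\mathcal{M}(n)\to\mathcal{M}(n-1)$ and degeneracies $s_j:\mathcal{M}(n)\to\mathcal{M}(n+1)$ of the underlying simplicial $k$-module given, for $x\in\mathcal{M}(n)$, by $$d_i(x)=\mu\bullet_i x\ \ (i=0,\dots,n-1),\qquad d_n(x)=\mu\bullet_0 t(x),\qquad s_j(x)=e\bullet_{j+1}x\ \ (j=0,\dots,n).$$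
   Context: Unadorned tensor products are over $k$. Operad with multiplication. An operad (non-$\Sigma$, in $k$-modules) is a sequence $\{\mathcal{O}(n)\}_{n\ge0}$ of $k$-modules with $k$-bilinear operations $\circ_i:\mathcal{O}(p)\otimes\mathcal{O}(q)\to\mathcal{O}(p+q-1)$ and an identity $\mathbb{1}\in\mathcal{O}(1)$ such that for $\varphi\in\mathcal{O}(p)$, $\psi\in\mathcal{O}(q)$, $\chi\in\mathcal{O}(r)$: $\varphi\circ_i\psi=0$ if $p<i$ or $p=0$; $$(\varphi\circ_i\psi)\circ_j\chi=\begin{cases}(\varphi\circ_j\chi)\circ_{i+r-1}\psi & j<i,\\ \varphi\circ_i(\psi\circ_{j-i+1}\chi) & i\le j<q+i,\\ (\varphi\circ_{j-q+1}\chi)\circ_i\psi & j\ge q+i;\end{cases}$$ and $\varphi\circ_i\mathbb{1}=\mathbb{1}\circ_1\varphi=\varphi$ for $i\le p$. It is an operad with multiplication if there are $\mu\in\mathcal{O}(2)$ and $e\in\mathcal{O}(0)$ (the unit) with $\mu\circ_1\mu=\mu\circ_2\mu$ and $\mu\circ_1e=\mu\circ_2e=\mathbb{1}$. Cyclic unital comp module over $\mathcal{O}$. This is a sequence $\{\mathcal{M}(n)\}_{n\ge0}$ of $k$-modules with $k$-linear maps $\bullet_i:\mathcal{O}(p)\otimes\mathcal{M}(n)\to\mathcal{M}(n-p+1)$, defined for $1\le i\le n-p+1$ when $0\le p\le n$ (declared zero if $p>n$), and for $i=0$ when $0\le p\le n+1$ (declared zero if $p>n+1$), together with $k$-linear maps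 $t:\mathcal{M}(n)\to\mathcal{M}(n)$ (with $t=\mathrm{id}$ on $\mathcal{M}(0)$), such that for $\varphi\in\mathcal{O}(p)$, $\psi\in\mathcal{O}(q)$, $x\in\mathcal{M}(n)$ and all indices $i,j\geq 0$ for which the operations are defined: if $p>0$, $$\varphi\bullet_i(\psi\bullet_jx)=\begin{cases}\psi\bullet_j(\varphi\bullet_{i+q-1}x)& j<i,\\ (\varphi\circ_{j-i+1}\psi)\bullet_ix& j-p<i\le j,\\ \psi\bullet_{j-p+1}(\varphi\bullet_ix)& 0\le i\le j-p;\end{cases}$$ if $p=0$, $$\varphi\bullet_i(\psi\bullet_jx)=\begin{cases}\psi\bullet_j(\varphi\bullet_{i+q-1}x)& j<i,\\ \psi\bullet_{j+1}(\varphi\bullet_ix)& 0\le i\le j;\end{cases}$$ $\mathbb{1}\bullet_ix=x$ for $i=0,\dots,n$; $\ t(\varphi\bullet_ix)=\varphi\bullet_{i+1}t(x)$ for $i=0,\dots,n-p$; and $t^{n+1}=\mathrm{id}$ on $\mathcal{M}(n)$. A cyclic $k$-module is meant in the standard sense (Connes, Loday): a simplicial $k$-module with operators $t$ satisfying $t^{n+1}=\mathrm{id}$, $d_it=td_{i-1}$ and $s_it=ts_{i-1}$ for $1\le i\le n$, $d_0t=d_n$, $s_0t=t^2s_n$ in degree $n$. *)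

(* Defs.v *)
From mathcomp Require Import all_boot all_algebra.

Set Implicit Arguments.
Unset Strict Implicit.
Unset Printing Implicit Defensive.

Import GRing.Theory.
Local Open Scope ring_scope.

(* Partial compositions O(p) x O(q) -> O(p + q - 1) take the target degree r   *)
(* and a proof of p + q = r + 1 instead of using the truncated p + q - 1.  So  *)
(* no transport between equal degrees is needed, and the composites of degree  *)
(* -1 (p = q = 0), which are zero by convention, simply do not exist.          *)
(* Indices are natural numbers; the admissible ones start at 1.  Bilinearity   *)
(* at the junk index 0 is no restriction, as that map is otherwise arbitrary.  *)
Record operad (k : comPzRingType) := Operad {
  operad_obj :> nat -> lmodType k;
  circ : forall p q r, (p + q = r.+1)%N -> nat ->
    operad_obj p -> operad_obj q -> operad_obj r;
  operad_id : operad_obj 1;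
  circ_linearl : forall p q r (E : (p + q = r.+1)%N) i (psi : operad_obj q),
    linear (fun phi => circ E i phi psi);
  circ_linearr : forall p q r (E : (p + q = r.+1)%N) i (phi : operad_obj p),
    linear (circ E i phi);
  circ_zero : forall p q r (E : (p + q = r.+1)%N) i
      (phi : operad_obj p) (psi : operad_obj q),
    (0 < i)%N -> (p < i)%N || (p == 0)%N -> circ E i phi psi = 0;
  circ_circ_lt : forall p q r m n l
      (E1 : (p + q = m.+1)%N) (E2 : (m + r = n.+1)%N)
      (E3 : (p + r = l.+1)%N) (E4 : (l + q = n.+1)%N) i j
      (phi : operad_obj p) (psi : operad_obj q) (chi : operad_obj r),
    (0 < j < i)%N ->
    circ E2 j (circ E1 i phi psi) chi =
    circ E4 (i + r - 1) (circ E3 j phi chi) psi;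
  circ_circ_mid : forall p q r m n l
      (E1 : (p + q = m.+1)%N) (E2 : (m + r = n.+1)%N)
      (E3 : (q + r = l.+1)%N) (E4 : (p + l = n.+1)%N) i j
      (phi : operad_obj p) (psi : operad_obj q) (chi : operad_obj r),
    (0 < i)%N -> (i <= j < q + i)%N ->
    circ E2 j (circ E1 i phi psi) chi =
    circ E4 i phi (circ E3 (j - i + 1) psi chi);
  circ_circ_ge : forall p q r m n l
      (E1 : (p + q = m.+1)%N) (E2 : (m + r = n.+1)%N)
      (E3 : (p + r = l.+1)%N) (E4 : (l + q = n.+1)%N) i j
      (phi : operad_obj p) (psi : operad_obj q) (chi : operad_obj r),
    (0 < i)%N -> (q + i <= j)%N ->
    circ E2 j (circ E1 i phi psi) chi =
    circ E4 i (circ E3 (j - q + 1) phi chi) psi;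
  circ_id : forall p i (phi : operad_obj p),
    (0 < i <= p)%N -> circ (addn1 p) i phi operad_id = phi;
  id_circ : forall p (phi : operad_obj p), circ (add1n p) 1 operad_id phi = phi
}.

Definition is_multiplication (k : comPzRingType) (O : operad k)
    (mu : O 2) (e : O 0) : Prop :=
  [/\ circ (erefl : (2 + 2 = 4)%N) 1 mu mu = circ (erefl : (2 + 2 = 4)%N) 2 mu mu,
      circ (erefl : (2 + 0 = 2)%N) 1 mu e = operad_id O &
      circ (erefl : (2 + 0 = 2)%N) 2 mu e = operad_id O].

(* Here too the operation O(p) x M(n) -> M(n - p + 1) takes its target degree  *)
(* m with a proof of p + m = n + 1; such an m exists iff p <= n + 1.  Given    *)
(* E : p + m = n + 1, the operation with index i is defined iff i <= m: for    *)
(* i = 0 this is no condition, and for i > 0 it amounts to p <= n and          *)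
(* 1 <= i <= n - p + 1.  When j <= a and i <= b, the operations on the         *)
(* right-hand sides of the three bullet_bullet axioms are then defined too.    *)
(* For p = 0 the axiom bullet_bullet_mid is void, and the other two are the    *)
(* two cases of the relation for p = 0.                                        *)
Record cyclicCompModule (k : comPzRingType) (O : operad k) := CyclicCompModule {
  comp_obj :> nat -> lmodType k;
  bullet : forall p n m, (p + m = n.+1)%N -> nat ->
    O p -> comp_obj n -> comp_obj m;
  comp_t : forall n, {linear comp_obj n -> comp_obj n};
  bullet_linearl : forall p n m (E : (p + m = n.+1)%N) i (x : comp_obj n),
    linear (fun phi => bullet E i phi x);
  bullet_linearr : forall p n m (E : (p + m = n.+1)%N) i (phi : O p),
    linear (bullet E i phi);
  bullet_zero : forall p n m (E : (p + m = n.+1)%N) i (phi : O p)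
      (x : comp_obj n),
    (0 < i)%N -> (n < p)%N -> bullet E i phi x = 0;
  bullet_bullet_lt : forall p q n a b c
      (E1 : (q + a = n.+1)%N) (E2 : (p + b = a.+1)%N)
      (E3 : (p + c = n.+1)%N) (E4 : (q + b = c.+1)%N) i j
      (phi : O p) (psi : O q) (x : comp_obj n),
    (j <= a)%N -> (i <= b)%N -> (j < i)%N ->
    bullet E2 i phi (bullet E1 j psi x) =
    bullet E4 j psi (bullet E3 (i + q - 1) phi x);
  bullet_bullet_mid : forall p q n a b r
      (E1 : (q + a = n.+1)%N) (E2 : (p + b = a.+1)%N)
      (E3 : (p + q = r.+1)%N) (E4 : (r + b = n.+1)%N) i j
      (phi : O p) (psi : O q) (x : comp_obj n),
    (j <= a)%N -> (i <= b)%N -> (i <= j < i + p)%N ->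
    bullet E2 i phi (bullet E1 j psi x) =
    bullet E4 i (circ E3 (j - i + 1) phi psi) x;
  bullet_bullet_ge : forall p q n a b c
      (E1 : (q + a = n.+1)%N) (E2 : (p + b = a.+1)%N)
      (E3 : (p + c = n.+1)%N) (E4 : (q + b = c.+1)%N) i j
      (phi : O p) (psi : O q) (x : comp_obj n),
    (j <= a)%N -> (i <= b)%N -> (i + p <= j)%N ->
    bullet E2 i phi (bullet E1 j psi x) =
    bullet E4 (j - p + 1) psi (bullet E3 i phi x);
  bullet_id : forall n i (x : comp_obj n),
    (i <= n)%N -> bullet (add1n n) i (operad_id O) x = x;
  comp_t_bullet : forall p n m (E : (p + m = n.+1)%N) i (phi : O p)
      (x : comp_obj n),
    (i < m)%N -> comp_t m (bullet E i phi x) = bullet E i.+1 phi (comp_t n x);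
  comp_t0 : forall x : comp_obj 0, comp_t 0 x = x;
  comp_t_cyclic : forall n (x : comp_obj n), iter n.+1 (comp_t n) x = x
}.

(* [face C n i] is d_i in degree n + 1, meaningful for i <= n + 1, and         *)
(* [degen C n i] is s_i in degree n, meaningful for i <= n; the maps at other  *)
(* indices are unconstrained.                                                  *)
Record simplicialModule (k : comPzRingType) (C : nat -> lmodType k) :=
    SimplicialModule {
  face : forall n, nat -> {linear C n.+1 -> C n};
  degen : forall n, nat -> {linear C n -> C n.+1};
  face_face : forall n i j (x : C n.+2), (i < j <= n.+2)%N ->
    face n i (face n.+1 j x) = face n j.-1 (face n.+1 i x);
  degen_degen : forall n i j (x : C n), (i <= j <= n)%N ->
    degen n.+1 i (degen n j x) = degen n.+1 j.+1 (degen n i x);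
  face_degen_lt : forall n i j (x : C n.+1), (i < j <= n.+1)%N ->
    face n.+1 i (degen n.+1 j x) = degen n j.-1 (face n i x);
  face_degen_eq : forall n j (x : C n), (j <= n)%N ->
    face n j (degen n j x) = x;
  face_degen_eqS : forall n j (x : C n), (j <= n)%N ->
    face n j.+1 (degen n j x) = x;
  face_degen_gt : forall n i j (x : C n.+1), (j.+1 < i <= n.+2)%N ->
    face n.+1 i (degen n.+1 j x) = degen n j (face n i.-1 x)
}.

Record cyclicModule (k : comPzRingType) (C : nat -> lmodType k) :=
    CyclicModule {
  underlying_simplicial :> simplicialModule C;
  cyc : forall n, {linear C n -> C n};
  cyc_cyclic : forall n (x : C n), iter n.+1 (cyc n) x = x;
  face_cyc : forall n i (x : C n.+1), (1 <= i <= n.+1)%N ->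
    face underlying_simplicial n i (cyc n.+1 x) =
    cyc n (face underlying_simplicial n i.-1 x);
  face0_cyc : forall n (x : C n.+1),
    face underlying_simplicial n 0 (cyc n.+1 x) =
    face underlying_simplicial n n.+1 x;
  degen_cyc : forall n i (x : C n), (1 <= i <= n)%N ->
    degen underlying_simplicial n i (cyc n x) =
    cyc n.+1 (degen underlying_simplicial n i.-1 x);
  degen0_cyc : forall n (x : C n),
    degen underlying_simplicial n 0 (cyc n x) =
    cyc n.+1 (cyc n.+1 (degen underlying_simplicial n n x))
}.

(* Main.v *)
Require Import Defs.
From HB Require Import structures.
From mathcomp Require Import all_boot all_algebra.

(** The relations not involving the last face [d_(n+1) = mu •_0 t] are instances
    of the comp module relations, associativity of [mu] and the unit laws.  The
    last face and the extra degeneracy [e •_0] are reduced to them by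
    [comp_t_bullet_last]: since [t] has order [n + 1] on [M(n)], commuting [t]
    with [•_i] all the way around gives [t (phi •_m x) = phi •_0 t^p x] for
    [phi] in [O(p)] and [x] in [M(p + m - 1)]. *)

(** Lets [bullet E i phi] be used as a bundled linear map, as faces and degeneracies require. *)
HB.instance Definition _ (k : comPzRingType) (O : operad k)
    (M : cyclicCompModule O) p n m (E : (p + m = n.+1)%N) i (phi : O p) :=
  GRing.isLinear.Build k (M n) (M m) *:%R (bullet E i phi)
    (bullet_linearr E i phi).

Section CompModule.

Context {k : comPzRingType} {O : operad k} (M : cyclicCompModule O).

Lemma iter_comp_t_bullet p n m (E : (p + m = n.+1)%N) r i (phi : O p)
    (x : M n) :
  (i + r <= m)%N ->
  iter r (comp_t M m) (bullet E i phi x) =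
  bullet E (i + r) phi (iter r (comp_t M n) x).
Proof.
elim: r => [|r IHr] ir; first by rewrite addn0.
rewrite addnS in ir *.
by rewrite !iterS IHr ?(ltnW ir) // comp_t_bullet.
Qed.

Lemma comp_t_bullet_last p n m (E : (p + m = n.+1)%N) (phi : O p) (x : M n) :
  comp_t M m (bullet E m phi x) = bullet E 0 phi (iter p (comp_t M n) x).
Proof.
(* Of the [m + 1] copies of [t] put in front of the right-hand side, one stays outside; the other
   [m] move inside, raise the index from 0 to [m] and leave [t^(m + p) = t^(n + 1)] on [x]. *)
rewrite -[RHS]comp_t_cyclic iterS iter_comp_t_bullet // add0n -iterD.
by rewrite addnC E comp_t_cyclic.
Qed.

Lemma bullet_idE n (E : (1 + n = n.+1)%N) i (x : M n) :
  (i <= n)%N -> bullet E i (operad_id O) x = x.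
Proof. by move=> lein; rewrite (eq_irrelevance E (add1n n)) bullet_id. Qed.

End CompModule.

Section CyclicModule.

Context {k : comPzRingType} {O : operad k} {mu : O 2} {e : O 0}.
Context (mu_mult : is_multiplication mu e) (M : cyclicCompModule O).

Local Notation t := (comp_t M _).
Local Notation "'mu_[' i ] x" :=
  (bullet (erefl : (2 + _ = _.+2)%N) i mu x) (at level 10, x at level 9).
Local Notation "'e_[' i ] x" :=
  (bullet (erefl : (0 + _.+1 = _.+1)%N) i e x) (at level 10, x at level 9).

Lemma mu_mu_lt n i j (x : M n.+2) : (j < i)%N -> (i <= n)%N ->
  mu_[i] (mu_[j] x) = mu_[j] (mu_[i.+1] x).
Proof.
move=> ltji lein.
have lejn : (j <= n.+1)%N by exact: leq_trans (ltnW ltji) (leqW lein).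
by rewrite (bullet_bullet_lt _ _ (erefl : 2 + n.+1 = n.+3)
  (erefl : 2 + n = n.+2)) // addn2 subn1.
Qed.

(** The middle relation turns the two sides into [mu ∘_2 mu] and [mu ∘_1 mu] acting at [i]. *)
Lemma mu_mu_assoc n i (x : M n.+2) : (i <= n)%N ->
  mu_[i] (mu_[i.+1] x) = mu_[i] (mu_[i] x).
Proof.
move=> lein; have [muA _ _] := mu_mult; pose E4 : (3 + n = n.+3)%N := erefl.
rewrite (bullet_bullet_mid _ _ (erefl : 2 + 2 = 4) E4) //; last first.
  by rewrite addn2 leqnSn leqnn.
rewrite (bullet_bullet_mid _ _ (erefl : 2 + 2 = 4) E4) ?(leqW lein) //.
  by rewrite subSnn subnn muA.
by rewrite addn2 leqnn ltnS leqnSn.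
Qed.

Lemma mu_e_lt n i j (x : M n.+1) : (i.+1 < j)%N -> (j <= n.+2)%N ->
  mu_[i] (e_[j] x) = e_[j.-1] (mu_[i] x).
Proof.
case: j => // j; rewrite !ltnS => ltij lejn.
have lein : (i <= n.+1)%N by exact: leq_trans (ltnW ltij) lejn.
rewrite (bullet_bullet_ge _ _ (erefl : 2 + n = n.+2)
  (erefl : 0 + n.+1 = n.+1)) //.
  by rewrite addn1 subSS subn1 prednK //; case: j ltij {lejn}.
by rewrite addn2.
Qed.

(** The left-hand side is [mu ∘_(j - i + 1) e] acting at [i], and the two values of [j] correspond
    to the two unit laws. *)
Lemma mu_e_id n i j (x : M n) : (i <= n)%N -> (i <= j <= i.+1)%N ->
  mu_[i] (e_[j] x) = x.
Proof.
move=> lein /andP[leij leji]; have [_ mue1 mue2] := mu_mult.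
have lejn : (j <= n.+1)%N by exact: leq_trans leji _.
rewrite (bullet_bullet_mid _ _ (erefl : 2 + 0 = 2)
  (erefl : 1 + n = n.+1)) //; last first.
  by rewrite leij addn2 ltnS.
case: ltngtP leij => // [ltij|<-] _; last by rewrite subnn mue1 bullet_idE.
have /eqP-> : j == i.+1 by rewrite eqn_leq leji.
by rewrite subSnn mue2 bullet_idE.
Qed.

Lemma mu_e_gt n i j (x : M n.+1) : (j < i)%N -> (i <= n.+1)%N ->
  mu_[i] (e_[j] x) = e_[j] (mu_[i.-1] x).
Proof.
move=> ltji lein; have lejn : (j <= n.+2)%N.
  by apply: leq_trans (ltnW ltji) (leqW lein).
rewrite (bullet_bullet_lt _ _ (erefl : 2 + n = n.+2)
  (erefl : 0 + n.+1 = n.+1)) //.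
by rewrite addn0 subn1.
Qed.

Lemma e_e n i j (x : M n) : (i <= j <= n.+1)%N ->
  e_[i] (e_[j] x) = e_[j.+1] (e_[i] x).
Proof.
case/andP=> leij lejn; have lein := leqW (leq_trans leij lejn).
rewrite (bullet_bullet_ge _ _ (erefl : 0 + n.+1 = n.+1)
  (erefl : 0 + n.+2 = n.+2)) ?addn0 //.
by rewrite subn0 addn1.
Qed.

(** All indices above [n] share the formula of the last face; only [n.+1] among them is
    meaningful. *)
Definition cface n i : {linear M n.+1 -> M n} :=
  let E : (2 + n = n.+2)%N := erefl in
  if (i <= n)%N then bullet E i mu : {linear M n.+1 -> M n}
  else bullet E 0 mu \o comp_t M n.+1.

(** The shift leaves index 0 to the extra degeneracy, which is [t] applied to [s_n]. *)
Definition cdegen n j : {linear M n -> M n.+1} :=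
  bullet (erefl : (0 + n.+1 = n.+1)%N) j.+1 e.

Lemma cfaceE n i (x : M n.+1) : (i <= n)%N -> cface n i x = mu_[i] x.
Proof. by rewrite /cface => ->. Qed.

Lemma cface_last n (x : M n.+1) : cface n n.+1 x = mu_[0] (t x).
Proof. by rewrite /cface ltnn. Qed.

Lemma cface_face n i j (x : M n.+2) : (i < j <= n.+2)%N ->
  cface n i (cface n.+1 j x) = cface n j.-1 (cface n.+1 i x).
Proof.
case/andP=> ltij; rewrite leq_eqVlt => /predU1P[Dj | lejn].
  rewrite {j}Dj /= in ltij *; rewrite !cface_last (cfaceE n.+1 i) //.
  move: ltij; rewrite ltnS leq_eqVlt => /predU1P[-> | lein].
    (* Two last faces: both sides act on [t^2 x], the left with [mu] at 1 then 0, the right with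
       [mu] at 0 twice. *)
    by rewrite cface_last comp_t_bullet_last comp_t_bullet // mu_mu_assoc.
  rewrite cfaceE // comp_t_bullet //.
  (* With [t] moved inside, both sides act on [t x]; at [i = 0] the two products overlap, otherwise
     they are disjoint. *)
  by case: i lein => [|i] lein; rewrite ?mu_mu_assoc // mu_mu_lt.
case: j ltij lejn => // j; rewrite !ltnS /= => leij lejn.
have lein := leq_trans leij lejn.
rewrite !cfaceE ?(leqW lein) //.
move: leij; rewrite leq_eqVlt => /predU1P[-> | ltij]; first exact: mu_mu_assoc.
by rewrite (mu_mu_lt _ _ _ _ ltij).
Qed.

Lemma cdegen_degen n i j (x : M n) : (i <= j <= n)%N ->
  cdegen n.+1 i (cdegen n j x) = cdegen n.+1 j.+1 (cdegen n i x).
Proof. by move=> leijn; rewrite /cdegen /= e_e. Qed.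

Lemma cface_degen_lt n i j (x : M n.+1) : (i < j <= n.+1)%N ->
  cface n.+1 i (cdegen n.+1 j x) = cdegen n j.-1 (cface n i x).
Proof.
case/andP=> ltij lejn; have lein : (i <= n)%N by exact: leq_trans ltij lejn.
by rewrite !cfaceE ?(leqW lein) // /cdegen /= mu_e_lt //=; case: j ltij {lejn}.
Qed.

Lemma cface_degen_eq n j (x : M n) : (j <= n)%N ->
  cface n j (cdegen n j x) = x.
Proof. by move=> lejn; rewrite cfaceE // mu_e_id // leqnSn leqnn. Qed.

Lemma cface_degen_eqS n j (x : M n) : (j <= n)%N ->
  cface n j.+1 (cdegen n j x) = x.
Proof.
rewrite leq_eqVlt => /predU1P[-> | ltjn].
  (* As [e] has arity 0, [t (s_n x)] is [e •_0 x] with no [t] left on [x], and a unit law at index 0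
     applies. *)
  by rewrite cface_last /cdegen /= comp_t_bullet_last mu_e_id.
by rewrite cfaceE // mu_e_id // leqnn leqnSn.
Qed.

Lemma cface_degen_gt n i j (x : M n.+1) : (j.+1 < i <= n.+2)%N ->
  cface n.+1 i (cdegen n.+1 j x) = cdegen n j (cface n i.-1 x).
Proof.
case/andP=> ltji; rewrite leq_eqVlt => /predU1P[Di | lein].
  rewrite {i}Di /= in ltji *.
  (* Moving [t] inside raises the index of [e] to [j + 2], beyond the reach of [mu] at 0. *)
  by rewrite !cface_last /cdegen /= comp_t_bullet // mu_e_lt.
rewrite !cfaceE //; first exact: mu_e_gt.
by case: i ltji lein.
Qed.

Definition csimplicial : simplicialModule M :=
  SimplicialModule cface_face cdegen_degen cface_degen_lt cface_degen_eq
    cface_degen_eqS cface_degen_gt.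

Lemma cface_cyc n i (x : M n.+1) : (1 <= i <= n.+1)%N ->
  cface n i (t x) = t (cface n i.-1 x).
Proof.
case: i => // i /=; rewrite ltnS leq_eqVlt => /predU1P[-> | ltin].
  (* Both sides are [mu •_0 t^2 x], since [mu] has arity 2. *)
  by rewrite cface_last cfaceE // comp_t_bullet_last.
by rewrite !cfaceE ?(ltnW ltin) // comp_t_bullet.
Qed.

Lemma cface0_cyc n (x : M n.+1) : cface n 0 (t x) = cface n n.+1 x.
Proof. by rewrite cface_last cfaceE. Qed.

Lemma cdegen_cyc n i (x : M n) : (1 <= i <= n)%N ->
  cdegen n i (t x) = t (cdegen n i.-1 x).
Proof. by case: i => // i lein; rewrite /cdegen /= comp_t_bullet // ltnW. Qed.

(** The inner [t] turns [s_n] into the extra degeneracy; the outer one moves its index from 0 to 1,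
    that of [s_0]. *)
Lemma cdegen0_cyc n (x : M n) : cdegen n 0 (t x) = t (t (cdegen n n x)).
Proof. by rewrite /cdegen /= comp_t_bullet_last comp_t_bullet. Qed.

Definition ccyclic : cyclicModule M :=
  @CyclicModule _ _ csimplicial (comp_t M) (@comp_t_cyclic _ _ M)
    cface_cyc cface0_cyc cdegen_cyc cdegen0_cyc.

End CyclicModule.

Theorem proposition1p1 (k : comPzRingType) (O : operad k) (mu : O 2) (e : O 0)
    (mu_mult : is_multiplication mu e) (M : cyclicCompModule O) :
  exists C : cyclicModule M,
    [/\ forall n (x : M n), cyc C n x = comp_t M n x,
        forall n i (x : M n.+1), (i <= n)%N ->
          face C n i x = bullet (erefl : (2 + n = n.+2)%N) i mu x,
        forall n (x : M n.+1),
          face C n n.+1 x =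
            bullet (erefl : (2 + n = n.+2)%N) 0 mu (comp_t M n.+1 x)
      & forall n j (x : M n), (j <= n)%N ->
          degen C n j x = bullet (erefl : (0 + n.+1 = n.+1)%N) j.+1 e x].
Proof.
exists (ccyclic mu_mult M); split=> //.
- exact: cfaceE.
- exact: cface_last.
Qed.
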